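(* Let $\alpha>0$, let $M\in\mathbb{R}^{n\times n}$ be symmetric with $M\succeq0$, and let $\Xi_b=\{\xi\in\mathbb{R}^n\mid(\xi-a_j)^\top\Theta_j(\xi-a_j)\le1,\ j=1,\dots,N_e\}$. Set $$\tau_0=\max\left\{\frac{1}{\sqrt{c_\alpha}},\ \sqrt{\gamma_2\mathrm{Tr}\{MS_0^\alpha\}}\right\}.$$ Then the optimal value of the semi-definite program (in the variables $Q=Q^\top\in\mathbb{R}^{n\times n}$, $q\in\mathbb{R}^n$, $q_0,\eta\in\mathbb{R}$, $\beta,\tilde\beta\in\mathbb{R}^{N_e}$) $$\begin{aligned}\min_{Q,q,q_0,\eta,\beta,\tilde\beta}\ &\gamma_2\mathrm{Tr}\{QS_0^\alpha\}+q_0\\ \text{s.t.}\ &\eta\ge0,\ \beta_j\ge0,\ \tilde\beta_j\ge0,\ j=1,\dots,N_e,\\ &\begin{bmatrix}Q-\eta M & q & 0\\ q^\top & q_0-1 & 0\\ 0 & 0 & \eta\end{bmatrix}+\sum_{j=1}^{N_e}\beta_j\Phi_j+\frac{1}{\tau_0^\alpha}\begin{bmatrix}0&0&0\\ 0&\alpha+1&\frac{-\alpha}{2\tau_0}\\ 0&\frac{-\alpha}{2\tau_0}&0\end{bmatrix}\succeq0,\\ &\begin{bmatrix}Q & q\\ q^\top & q_0\end{bmatrix}+\sum_{j=1}^{N_e}\tilde\beta_j\tilde\Phi_j\succeq0,\quad Q\succeq0,\end{aligned}$$ with $$\tilde\Phi_j=\begin{bmatrix}\Theta_j&-\Theta_ja_j\\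 -a_j^\top\Theta_j&a_j^\top\Theta_ja_j-1\end{bmatrix},\qquad\Phi_j=\begin{bmatrix}\tilde\Phi_j&0\\ 0&0\end{bmatrix},$$ is always lower than or equal to the generalized $\alpha$-unimodal Gauss bound under unbounded support, namely $$\begin{cases} c_\alpha\gamma_2\,\mathrm{Tr}\{MS_0\}, & \text{if } c_\alpha\gamma_2\,\mathrm{Tr}\{MS_0\}\le \dfrac{\alpha}{\alpha+2},\\[2mm] 1-\dfrac{1}{\left(\gamma_2\,\mathrm{Tr}\{MS_0^\alpha\}\right)^{\alpha/2}}, & \text{otherwise.}\end{cases}$$
   Context: $S_0\succ0$ in $\mathbb{R}^{n\times n}$ is a nominal covariance matrix, and $\gamma_2\ge1$ is a real parameter. $c_\alpha=\left(\frac{2}{\alpha+2}\right)^{2/\alpha}$ and $S_0^\alpha=\frac{\alpha+2}{\alpha}S_0$ (the $\alpha$ in $S_0^\alpha$ is a superscript label, not a power). The data of $\Xi_b$ are $a_j\in\mathbb{R}^n$ and symmetric $\Theta_j\succeq0$ in $\mathbb{R}^{n\times n}$ (possibly degenerate ellipsoids). The optimal value of the minimization problem is understood as the infimum of the objective over the feasible set. *)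

(* Defs.v *)
From HB Require Import structures.
From mathcomp Require Import all_boot all_order all_algebra.
From mathcomp Require Import all_classical all_reals all_analysis.

Set Implicit Arguments.
Unset Strict Implicit.
Unset Printing Implicit Defensive.

Import Order.TTheory GRing.Theory Num.Theory.
Local Open Scope classical_set_scope.
Local Open Scope ring_scope.

Definition qform (R : realType) (n : nat) (A : 'M[R]_n) (x : 'cV[R]_n) : R :=
  (x^T *m A *m x) 0 0.

(* Symmetry is part of both (semi)definiteness predicates. *)
Definition psd (R : realType) (n : nat) (A : 'M[R]_n) : Prop :=
  A^T = A /\ forall x : 'cV[R]_n, 0 <= qform A x.

Definition pd (R : realType) (n : nat) (A : 'M[R]_n) : Prop :=
  A^T = A /\ forall x : 'cV[R]_n, x != 0 -> 0 < qform A x.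

Definition ellipsoids (R : realType) (n Ne : nat) (a : 'I_Ne -> 'cV[R]_n)
    (Theta : 'I_Ne -> 'M[R]_n) : set 'cV[R]_n :=
  [set xi | forall j, qform (Theta j) (xi - a j) <= 1].

Definition c_ (R : realType) (alpha : R) : R :=
  (2 / (alpha + 2)) `^ (2 / alpha).

Definition S_scaled (R : realType) (n : nat) (alpha : R) (S0 : 'M[R]_n) :
    'M[R]_n :=
  ((alpha + 2) / alpha) *: S0.

Definition tau0 (R : realType) (n : nat) (alpha gamma2 : R)
    (S0 M : 'M[R]_n) : R :=
  Num.max (1 / Num.sqrt (c_ alpha))
          (Num.sqrt (gamma2 * \tr (M *m S_scaled alpha S0))).

Definition tPhi (R : realType) (n : nat) (a : 'cV[R]_n) (Theta : 'M[R]_n) :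
    'M[R]_(n + 1) :=
  block_mx Theta             (- (Theta *m a))
           (- (a^T *m Theta)) (a^T *m Theta *m a - 1%:M).

Definition Phi (R : realType) (n : nat) (a : 'cV[R]_n) (Theta : 'M[R]_n) :
    'M[R]_(n + 1 + 1) :=
  block_mx (tPhi a Theta) 0 0 0.

(* 3 x 3 block matrices with block sizes n, 1, 1 are nested as
   (n + 1) + 1: the (n + 1) x (n + 1) corner is itself a block matrix. *)
Definition lmi1 (R : realType) (n Ne : nat) (alpha t : R) (M : 'M[R]_n)
    (a : 'I_Ne -> 'cV[R]_n) (Theta : 'I_Ne -> 'M[R]_n)
    (Q : 'M[R]_n) (q : 'cV[R]_n) (q0 eta : R) (beta : 'cV[R]_Ne) :
    'M[R]_(n + 1 + 1) :=
  block_mx (block_mx (Q - eta *: M) q q^T (q0 - 1)%:M) 0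
           0                                           eta%:M
  + \sum_(j < Ne) beta j 0 *: Phi (a j) (Theta j)
  + (1 / t `^ alpha) *:
    block_mx (block_mx (0 : 'M[R]_n) 0 0 (alpha + 1)%:M)
             (col_mx 0 (- alpha / (2 * t))%:M)
             (row_mx 0 (- alpha / (2 * t))%:M)
             0.

Definition lmi2 (R : realType) (n Ne : nat)
    (a : 'I_Ne -> 'cV[R]_n) (Theta : 'I_Ne -> 'M[R]_n)
    (Q : 'M[R]_n) (q : 'cV[R]_n) (q0 : R) (tbeta : 'cV[R]_Ne) :
    'M[R]_(n + 1) :=
  block_mx Q q q^T q0%:M + \sum_(j < Ne) tbeta j 0 *: tPhi (a j) (Theta j).

Definition sdp_feasible (R : realType) (n Ne : nat) (alpha t : R)
    (M : 'M[R]_n) (a : 'I_Ne -> 'cV[R]_n) (Theta : 'I_Ne -> 'M[R]_n)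
    (Q : 'M[R]_n) (q : 'cV[R]_n) (q0 eta : R) (beta tbeta : 'cV[R]_Ne) : Prop :=
  [/\ Q^T = Q,
      0 <= eta /\ (forall j, 0 <= beta j 0 /\ 0 <= tbeta j 0),
      psd (lmi1 alpha t M a Theta Q q q0 eta beta),
      psd (lmi2 a Theta Q q q0 tbeta)
    & psd Q].

(* Extended-real infimum: +oo when infeasible, -oo when unbounded below. *)
Definition sdp_value (R : realType) (n Ne : nat) (alpha gamma2 : R)
    (S0 M : 'M[R]_n) (a : 'I_Ne -> 'cV[R]_n) (Theta : 'I_Ne -> 'M[R]_n) :
    \bar R :=
  ereal_inf [set v : \bar R |
    exists (Q : 'M[R]_n) (q : 'cV[R]_n) (q0 eta : R) (beta tbeta : 'cV[R]_Ne),
      sdp_feasible alpha (tau0 alpha gamma2 S0 M) M a Theta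
        Q q q0 eta beta tbeta
      /\ v = (gamma2 * \tr (Q *m S_scaled alpha S0) + q0)%:E].

Definition gauss_bound (R : realType) (n : nat) (alpha gamma2 : R)
    (S0 M : 'M[R]_n) : R :=
  if c_ alpha * gamma2 * \tr (M *m S0) <= alpha / (alpha + 2)
  then c_ alpha * gamma2 * \tr (M *m S0)
  else 1 - 1 / (gamma2 * \tr (M *m S_scaled alpha S0)) `^ (alpha / 2).

(* Main.v *)
Require Import Defs.
From HB Require Import structures.
From mathcomp Require Import all_boot all_order all_algebra.
From mathcomp Require Import all_classical all_reals all_analysis.
From mathcomp Require Import ring.

(** The bound is attained by one explicit feasible point, which ignores the
    support constraints (all multipliers vanish) and is a multiple of [M]:
    [Q = eta M], [q = 0], with, for [t = tau0] and [u = 1 / t ^ alpha],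

      [eta = (alpha / 2) u / t ^ 2]   and   [q0 = 1 - (alpha / 2 + 1) u].

    With [Q = eta M] the first matrix inequality only concerns its last two
    coordinates, where it bounds the product of [q0 - 1 + (alpha + 1) u] and
    [eta] below by [(alpha u / (2 t)) ^ 2].  The choice above makes this an
    equality: the matrix becomes [alpha u / 2] times the square of the vector
    [(0, 1, - 1 / t)] ([lmi1_gauss_outer]).  The second inequality is block
    diagonal and reduces to [0 <= q0], that is [(alpha + 2) / 2 <= t ^ alpha],
    which holds because [t] is at least [1 / sqrt c_alpha], the point where
    equality occurs ([gauss_threshold_powR]).

    Write [T = gamma2 Tr (M S_scaled)]; the objective at this point is
    [T eta + q0].  The two cases of the bound correspond to the two terms of
    the maximum that defines [t].  If [T <= 1 / c_alpha], then [t] is the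
    threshold, [q0 = 0] and the objective is linear in [T]; otherwise
    [t ^ 2 = T] and the objective is
    [alpha u / 2 + 1 - (alpha / 2 + 1) u = 1 - u]. *)

Import Order.TTheory GRing.Theory Num.Theory.
Local Open Scope classical_set_scope.
Local Open Scope ring_scope.

Lemma psd_scale (R : realType) (n : nat) (k : R) (A : 'M[R]_n) :
  0 <= k -> psd A -> psd (k *: A).
Proof.
move=> k0 [AT A0]; split=> [|x]; first by rewrite linearZ /= AT.
by rewrite /qform -scalemxAr -scalemxAl mxE mulr_ge0 // A0.
Qed.

Lemma psd_outer (R : realType) (n : nat) (v : 'cV[R]_n) : psd (v *m v^T).
Proof.
split=> [|x]; first by rewrite trmx_mul trmxK.
rewrite /qform mulmxA -mulmxA mxE big_ord1.
have -> : x^T *m v = (v^T *m x)^T by rewrite trmx_mul trmxK.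
by rewrite mxE -expr2 sqr_ge0.
Qed.

Lemma psd_block_diag (R : realType) (m n : nat) (A : 'M[R]_m) (B : 'M[R]_n) :
  psd A -> psd B -> psd (block_mx A 0 0 B).
Proof.
move=> [AT A0] [BT B0]; split=> [|x]; first by rewrite tr_block_mx AT BT !trmx0.
rewrite /qform -[x]vsubmxK tr_col_mx mul_row_block mul_row_col.
by rewrite !mulmx0 addr0 add0r mxE addr_ge0 // ?A0 ?B0.
Qed.

Lemma psd_scalar (R : realType) (n : nat) (k : R) :
  0 <= k -> psd (k%:M : 'M[R]_n).
Proof.
move=> k0; rewrite -scalemx1; apply: psd_scale => //; split=> [|x].
  by rewrite trmx1.
rewrite /qform mulmx1 mxE sumr_ge0 // => i _.
by rewrite mxE -expr2 sqr_ge0.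
Qed.

Lemma c_gt0 (R : realType) (alpha : R) : 0 < alpha -> 0 < c_ alpha.
Proof. by move=> a0; rewrite powR_gt0 // divr_gt0 ?addr_gt0. Qed.

(** The constant [c_alpha] is normalized so that the two regimes of the Gauss
    bound meet where [t ^ alpha = (alpha + 2) / 2]. *)
Lemma gauss_threshold_powR (R : realType) (alpha : R) :
  0 < alpha -> (1 / Num.sqrt (c_ alpha)) `^ alpha = (alpha + 2) / 2.
Proof.
move=> a0; have c0 := c_gt0 _ _ a0.
have b0 : 0 < 2 / (alpha + 2) by rewrite divr_gt0 ?addr_gt0.
rewrite div1r -powR12_sqrt ?ltW// -powRN /c_ -!powRrM.
have -> : 2 / alpha * (- 2^-1 * alpha) = -1.
  by field; rewrite gt_eqF.
by rewrite powR_inv1 ?ltW// invf_div.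
Qed.

Lemma tau0_gt0 (R : realType) (n : nat) (alpha gamma2 : R) (S0 M : 'M[R]_n) :
  0 < alpha -> 0 < tau0 alpha gamma2 S0 M.
Proof.
by move=> a0; rewrite lt_max divr_gt0 // sqrtr_gt0 c_gt0.
Qed.

Lemma tau0_powR_ge (R : realType) (n : nat) (alpha gamma2 : R)
    (S0 M : 'M[R]_n) :
  0 < alpha -> (alpha + 2) / 2 <= tau0 alpha gamma2 S0 M `^ alpha.
Proof.
move=> a0; rewrite -gauss_threshold_powR //.
apply: ge0_ler_powR; rewrite ?nnegrE ?(ltW a0) ?(ltW (tau0_gt0 _ _ _ _ _ _ _)) //.
by rewrite le_max lexx.
Qed.

(** For [t ^ 2 = T], the pair [(gauss_eta, gauss_q0)] minimizes [T eta + q0] on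
    the branch [0 < eta] of the hyperbola
    [(q0 - 1 + (alpha + 1) u) eta = (alpha u / (2 t)) ^ 2], where
    [u = 1 / t ^ alpha]; this is where the values come from. *)
Definition gauss_eta {R : realType} (alpha t : R) : R :=
  alpha / 2 * (t `^ alpha)^-1 / t ^+ 2.

Definition gauss_q0 {R : realType} (alpha t : R) : R :=
  1 - (alpha / 2 + 1) * (t `^ alpha)^-1.

(** With these choices the lower right 2 x 2 corner has determinant zero, so the
    whole matrix is a nonnegative multiple of a rank-one square. *)
Lemma lmi1_gauss_outer (R : realType) (n Ne : nat) (alpha t : R) (M : 'M[R]_n)
    (a : 'I_Ne -> 'cV[R]_n) (Theta : 'I_Ne -> 'M[R]_n) :
  0 < t ->
  let v : 'cV[R]_(n + 1 + 1) := col_mx (col_mx 0 1%:M) (- t^-1)%:M in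
  lmi1 alpha t M a Theta (gauss_eta alpha t *: M) 0 (gauss_q0 alpha t)
    (gauss_eta alpha t) 0
  = (alpha / 2 * (t `^ alpha)^-1) *: (v *m v^T).
Proof.
move=> t0 v.
rewrite /lmi1 big1 => [|j _]; last by rewrite mxE scale0r.
rewrite addr0 subrr trmx0 /v !tr_col_mx !tr_scalar_mx trmx0.
rewrite mul_col_row mul_col_row mul_mx_row mul_col_mx.
rewrite !scale_block_mx !add_block_mx.
rewrite !mulmx0 !mul0mx -!scalar_mxM.
rewrite !scale_row_mx !scale_col_mx !scaler0 !addr0 !add0r !scale_scalar_mx.
have tp : t `^ alpha != 0 by rewrite gt_eqF // powR_gt0.
have tn : t != 0 by rewrite gt_eqF.
rewrite -raddfD /= /gauss_eta /gauss_q0.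
congr block_mx.
- by congr block_mx; congr (_%:M); field; rewrite ?tp ?tn.
- by congr (col_mx 0 _%:M); field; rewrite ?tp ?tn.
- by congr (row_mx 0 _%:M); field; rewrite ?tp ?tn.
- by congr (_%:M); field; rewrite ?tp ?tn.
Qed.

(** The factor [(alpha + 2) / alpha] of the scaled covariance cancels the right
    hand side of the case condition; in this form the condition decides which
    term of the maximum defining [tau0] is the larger one. *)
Lemma gauss_case_scaled (R : realType) (n : nat) (alpha gamma2 : R)
    (S0 M : 'M[R]_n) :
  0 < alpha ->
  (c_ alpha * gamma2 * \tr (M *m S0) <= alpha / (alpha + 2))
  = (gamma2 * \tr (M *m S_scaled alpha S0) <= (c_ alpha)^-1).
Proof.
move=> a0; have c0 := c_gt0 _ _ a0.
have a2 : 0 < alpha + 2 by rewrite addr_gt0.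
rewrite -[RHS](ler_pM2l c0) divff ?gt_eqF// /S_scaled -scalemxAr mxtraceZ.
rewrite -[LHS](ler_pM2l (divr_gt0 a2 a0)).
by congr (_ <= _); field; rewrite ?gt_eqF.
Qed.

Lemma gauss_objective (R : realType) (n : nat) (alpha gamma2 : R)
    (S0 M : 'M[R]_n) :
  0 < alpha ->
  let t := tau0 alpha gamma2 S0 M in
  gamma2 * \tr ((gauss_eta alpha t *: M) *m S_scaled alpha S0)
    + gauss_q0 alpha t
  = gauss_bound alpha gamma2 S0 M.
Proof.
move=> a0 t; have c0 := c_gt0 _ _ a0.
have a2 : 0 < alpha + 2 by rewrite addr_gt0.
rewrite -scalemxAl mxtraceZ mulrCA.
rewrite /gauss_bound gauss_case_scaled //.
case: ifPn => [small|].
- have -> : t = 1 / Num.sqrt (c_ alpha).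
    apply/max_idPl; rewrite div1r -sqrtrV ?(ltW c0) //.
    exact: ler_wsqrtr.
  rewrite /gauss_eta /gauss_q0 gauss_threshold_powR //.
  rewrite expr_div_n expr1n sqr_sqrtr ?ltW// /S_scaled -scalemxAr mxtraceZ.
  by field; rewrite ?gt_eqF.
- rewrite -ltNge => large.
  set T := gamma2 * _ in large *.
  have T0 : 0 < T by apply: lt_trans large; rewrite invr_gt0.
  have -> : t = Num.sqrt T.
    apply/max_idPr; rewrite div1r -sqrtrV ?(ltW c0) //.
    by rewrite ler_wsqrtr // ltW.
  rewrite /gauss_eta /gauss_q0 sqr_sqrtr ?ltW//.
  have -> : Num.sqrt T `^ alpha = T `^ (alpha / 2).
    by rewrite -powR12_sqrt ?ltW// -powRrM mulrC.
  have Tp : T `^ (alpha / 2) != 0 by rewrite gt_eqF // powR_gt0.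
  by field; rewrite Tp gt_eqF.
Qed.

Lemma gauss_eta_ge0 (R : realType) (alpha t : R) :
  0 < alpha -> 0 <= gauss_eta alpha t.
Proof.
by move=> a0; rewrite !mulr_ge0 ?invr_ge0 ?powR_ge0 ?sqr_ge0 // ltW.
Qed.

Lemma gauss_q0_ge0 (R : realType) (alpha t : R) :
  0 < alpha -> (alpha + 2) / 2 <= t `^ alpha -> 0 <= gauss_q0 alpha t.
Proof.
move=> a0 ht; rewrite subr_ge0.
have p0 : 0 < t `^ alpha by apply: lt_le_trans ht; rewrite divr_gt0 ?addr_gt0.
rewrite ler_pdivrMr // mul1r; apply: le_trans ht.
by rewrite mulrDl divff.
Qed.

Lemma gauss_feasible (R : realType) (n Ne : nat) (alpha t : R) (M : 'M[R]_n)
    (a : 'I_Ne -> 'cV[R]_n) (Theta : 'I_Ne -> 'M[R]_n) :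
  0 < alpha -> 0 < t -> (alpha + 2) / 2 <= t `^ alpha -> psd M ->
  sdp_feasible alpha t M a Theta (gauss_eta alpha t *: M) 0
    (gauss_q0 alpha t) (gauss_eta alpha t) 0 0.
Proof.
move=> a0 t0 ht hM.
have eta0 : 0 <= gauss_eta alpha t by exact: gauss_eta_ge0.
have psdQ : psd (gauss_eta alpha t *: M) by exact: psd_scale.
split=> //.
- by case: psdQ.
- by split=> // j; rewrite mxE.
- rewrite lmi1_gauss_outer //; apply: psd_scale; last exact: psd_outer.
  by rewrite mulr_ge0 ?invr_ge0 ?powR_ge0 // divr_ge0 // ltW.
- rewrite /lmi2 big1 => [|j _]; last by rewrite mxE scale0r.
  rewrite addr0 trmx0; apply: psd_block_diag => //.
  by apply: psd_scalar; exact: gauss_q0_ge0.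
Qed.

Theorem theorem7 (R : realType) (n Ne : nat) (alpha gamma2 : R)
    (S0 M : 'M[R]_n)
    (a : 'I_Ne -> 'cV[R]_n) (Theta : 'I_Ne -> 'M[R]_n)
    (Xib : set 'cV[R]_n)
    (halpha : 0 < alpha) (hgamma2 : 1 <= gamma2)
    (hS0 : pd S0) (hM : psd M)
    (hTheta : forall j, psd (Theta j))
    (hXib : Xib = ellipsoids a Theta) :
  (sdp_value alpha gamma2 S0 M a Theta <= (gauss_bound alpha gamma2 S0 M)%:E)%E.
Proof.
apply: ereal_inf_lbound.
set t := tau0 alpha gamma2 S0 M.
exists (gauss_eta alpha t *: M), 0, (gauss_q0 alpha t), (gauss_eta alpha t), 0, 0.
split; last by rewrite gauss_objective.
by apply: gauss_feasible => //; [exact: tau0_gt0 | exact: tau0_powR_ge].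
Qed.
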